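(* The class $\mathcal T$ of all finite two-graphs has EPPA: for every finite two-graph $\mathbf A$ there exists a finite two-graph $\mathbf B$ containing $\mathbf A$ as an induced substructure such that every isomorphism between induced substructures of $\mathbf A$ extends to an automorphism of $\mathbf B$.
   Context: A two-graph is a 3-uniform hypergraph such that every set of four vertices contains an even number of hyperedges. Substructures are induced: a substructure of a two-graph $\mathbf B$ on a vertex set $S\subseteq B$ has as hyperedges exactly the hyperedges of $\mathbf B$ contained in $S$. A class $\mathcal C$ of finite structures has the extension property for partial automorphisms (EPPA) if for every $\mathbf A\in\mathcal C$ there is $\mathbf B\in\mathcal C$ containing $\mathbf A$ as an induced substructure such that every isomorphism between induced substructures of $\mathbf A$ (a partial automorphism of $\mathbf A$) extends to an automorphism of $\mathbf B$. *)

(* Defs.v *)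
From mathcomp Require Import all_boot.

Set Implicit Arguments.
Unset Strict Implicit.
Unset Printing Implicit Defensive.

Record hypergraph := Hypergraph {
  vertex :> finType;
  hyperedges : {set {set vertex}}
}.

Definition uniform (k : nat) (H : hypergraph) : Prop :=
  forall e : {set H}, e \in hyperedges H -> #|e| = k.

Definition two_graph (H : hypergraph) : Prop :=
  uniform 3 H /\
  (forall S : {set H}, #|S| = 4 ->
     ~~ odd #|[set e in hyperedges H | e \subset S]|).

(* For S : {set H}, the hyperedges of H contained in S are exactly the images
   under val of sets of elements of the subtype. *)
Definition induced (H : hypergraph) (S : {set H}) : hypergraph :=
  @Hypergraph {x : H | x \in S}
    [set e : {set {x : H | x \in S}} | val @: e \in hyperedges H].

(* Both directions on hyperedges are required, so an embedding is an
   isomorphism onto an induced substructure. *)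
Definition embedding (G H : hypergraph) (f : G -> H) : Prop :=
  injective f /\
  (forall e : {set G}, (f @: e \in hyperedges H) = (e \in hyperedges G)).

Definition isomorphism (G H : hypergraph) (f : G -> H) : Prop :=
  bijective f /\
  (forall e : {set G}, (f @: e \in hyperedges H) = (e \in hyperedges G)).

Definition automorphism (H : hypergraph) (f : H -> H) : Prop :=
  isomorphism f.

(* B contains A through the embedding iota. A partial automorphism of A is an
   isomorphism between two induced substructures; theta extends it when they
   agree, along iota, on its domain S. *)
Definition has_EPPA (C : hypergraph -> Prop) : Prop :=
  forall A : hypergraph, C A ->
  exists B : hypergraph, C B /\
  exists iota : A -> B, embedding iota /\
  forall (S S' : {set A}) (phi : induced S -> induced S'),
    isomorphism phi ->
    exists theta : B -> B, automorphism theta /\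
      forall x : induced S, theta (iota (val x)) = iota (val (phi x)).

(* Main.v *)
Require Import Defs.
From mathcomp Require Import all_boot perm.

(* A two-graph on V is the set of triples spanning an odd number of edges in
   some graph e on V, and e is determined up to switching, i.e. up to adding
   s x + s y (mod 2) to e x y.  Let B have the vertices (x, p) with
   p : V -> Z/2, and join (x, p) to (y, q) when p y + q x = 1; x is sent to
   (x, p_x) with p_x y + p_y x = e x y.  A partial automorphism extends to a
   permutation g of V, and transforms e by a switching s on its domain.  Then
   (x, p) |-> (g x, (p + F x) o g^-1) is an automorphism of the two-graph of B
   as soon as F x y + F y x = s x + s y; this leaves enough freedom to choose
   F x so that p_x is sent to p_(g x) for all x in the domain. *)

Set Implicit Arguments.
Unset Strict Implicit.
Unset Printing Implicit Defensive.

(** * Small sets, permutations and 3-uniform hypergraphs *)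

Lemma cards3 (T : finType) (a b c : T) :
  (#|[set a; b; c]| == 3) = uniq [:: a; b; c].
Proof.
rewrite setUC cardsU1 cards2 /= !inE andbT (eq_sym c a) (eq_sym c b).
by case: (a == b) (a == c) (b == c) => [] [] [].
Qed.

Lemma cards3_ex (T : finType) (E : {set T}) :
  #|E| = 3 -> exists a b c : T, uniq [:: a; b; c] /\ E = [set a; b; c].
Proof.
case/cards_eqP: E => [[|a [|b [|c []]]]] //= Us _; exists a, b, c; split=> //.
by apply/setP=> x; rewrite !inE orbA.
Qed.

Lemma cards4 (T : finType) (a b c d : T) :
  uniq [:: a; b; c; d] -> #|[set a; b; c; d]| = 4.
Proof.
move=> Us; have -> : [set a; b; c; d] = [set x in [:: a; b; c; d]].
  by apply/setP=> x; rewrite !inE !orbA.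
by rewrite cardsE (card_uniqP Us).
Qed.

Lemma cards4_ex (T : finType) (E : {set T}) :
  #|E| = 4 -> exists a b c d : T,
    uniq [:: a; b; c; d] /\ E = [set a; b; c; d].
Proof.
case/cards_eqP: E => [[|a [|b [|c [|d []]]]]] //= Us _.
exists a, b, c, d; split=> //.
by apply/setP=> x; rewrite !inE !orbA.
Qed.

(** List [S] then its complement, and [f @: S] then its complement: [g] matches these two
    enumerations position by position. *)
Lemma perm_extension (T : finType) (S : {set T}) (f : T -> T) :
  {in S &, injective f} -> exists g : {perm T}, {in S, g =1 f}.
Proof.
move=> f_inj; pose s := enum S ++ enum (~: S).
pose s' := map f (enum S) ++ enum (~: (f @: S)).
have mem_s x : x \in s by rewrite mem_cat !mem_enum inE orbN.
have size_s : size s = size s'.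
  rewrite !size_cat size_map -!cardE (cardsCs (~: S)) (cardsCs (~: (f @: S))).
  by rewrite !setCK card_in_imset.
have uniq_s' : uniq s'.
  rewrite cat_uniq enum_uniq andbT map_inj_in_uniq ?enum_uniq; last first.
    by move=> x y; rewrite !mem_enum; apply: f_inj.
  apply/hasPn=> x; rewrite mem_enum inE; apply: contra => /mapP[y].
  by rewrite mem_enum => yS ->; apply: imset_f.
pose g x := nth x s' (index x s).
have g_inj : injective g.
  move=> x y; have lt_s z : index z s < size s' by rewrite -size_s index_mem.
  (* [g] uses its own argument as the default of [nth]; the two defaults must agree before
     uniqueness of [s'] applies. *)
  rewrite /g (set_nth_default x y) // => /eqP; rewrite nth_uniq // => /eqP.
  by move/(congr1 (nth x s)); rewrite !nth_index.
exists (perm g_inj) => x xS; rewrite permE /g index_cat mem_enum xS nth_cat.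
have lt_x : index x (enum S) < size (enum S) by rewrite index_mem mem_enum.
by rewrite size_map lt_x (nth_map x) // nth_index // mem_enum.
Qed.

Lemma uniform3_embedding (G H : hypergraph) (f : G -> H) :
  uniform 3 G -> uniform 3 H -> injective f ->
  (forall x y z, ([set f x; f y; f z] \in hyperedges H)
                 = ([set x; y; z] \in hyperedges G)) ->
  embedding f.
Proof.
move=> uniG uniH f_inj fE; split=> // E; have [E3|E3] := eqVneq #|E| 3; last first.
  apply/idP/idP => [/uniH|/uniG] /eqP; last by rewrite (negPf E3).
  by rewrite card_imset ?(negPf E3).
have [x [y [z [_ ->]]]] := cards3_ex E3.
by rewrite !imsetU !imset_set1 fE.
Qed.

(** A hyperedge inside a four-set omits exactly one vertex, so the count runs over the omitted
    vertex. *)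
Lemma card_hyperedges4 (H : hypergraph) (a b c d : H) :
  uniform 3 H -> uniq [:: a; b; c; d] ->
  #|[set e in hyperedges H | e \subset [set a; b; c; d]]| =
  ([set b; c; d] \in hyperedges H) + ([set a; c; d] \in hyperedges H)
  + ([set a; b; d] \in hyperedges H) + ([set a; b; c] \in hyperedges H).
Proof.
move=> uniH Us; set S := [set a; b; c; d].
have S4 : #|S| = 4 by apply: cards4.
have D1_inj : {in S &, injective (fun x => S :\ x)}.
  move=> x y xS yS /setP/(_ x).
  by rewrite !in_setD1 eqxx xS andbT; case: eqVneq.
have -> : [set e in hyperedges H | e \subset S] =
          [set S :\ x | x in [set x in S | S :\ x \in hyperedges H]].
  apply/setP=> e; rewrite inE; apply/andP/imsetP=> [[eH eS]|[x]]; last first.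
    by rewrite inE => /andP[xS xH] ->; rewrite xH subsetDl.
  have /eqP/cards1P[x Dx] : #|S :\: e| = 1.
    by rewrite cardsD (setIidPr eS) S4 (uniH _ eH).
  have De : e = S :\ x by rewrite -Dx setDDr setDv set0U; apply/esym/setIidPr.
  exists x => //; rewrite inE -De eH andbT.
  by have: x \in S :\: e; [rewrite Dx set11 | case/setDP].
rewrite card_in_imset; last first.
  by move=> x y /setIdP[xS _] /setIdP[yS _]; apply: D1_inj.
rewrite -sum1_card big_mkcond /=.
under eq_bigr => x _ do rewrite inE.
rewrite -big_mkcond big_mkcondr /=.
rewrite (eq_bigl (mem [:: a; b; c; d])); last first.
  by move=> x; rewrite !inE !orbA.
rewrite -big_uniq //= !big_cons big_nil addn0 !addnA.
have ifE (P : bool) : (if P then 1 else 0) = P by case: P.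
rewrite !ifE; move: Us; rewrite /= !inE !negb_or andbT.
case/and3P => /and3P[ab ac ad] /andP[bc bd] cd.
have S_D1 x u v w : x \notin [:: u; v; w] -> S =i [:: x; u; v; w] ->
    S :\ x = [set u; v; w].
  move=> xuvw Sx; apply/setP=> y; rewrite in_setD1 Sx !inE -orbA.
  by case: (eqVneq y x) => [->|//]; rewrite !inE in xuvw; rewrite (negPf xuvw).
rewrite (S_D1 a b c d) ?(S_D1 b a c d) ?(S_D1 c a b d) ?(S_D1 d a b c) //.
all: try by move=> x; rewrite !inE -!orbA; do !bool_congr.
all: by rewrite !inE !negb_or ?[_ == a]eq_sym ?[d == _]eq_sym ?[c == b]eq_sym
  ?ab ?ac ?ad ?bc ?bd ?cd.
Qed.

(** * Passing between graphs and two-graphs *)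

Definition odd_triple (T : Type) (e : T -> T -> bool) (x y z : T) : bool :=
  e x y (+) e y z (+) e x z.

Section GraphTwoGraph.

Variables (T : finType) (e : rel T).
Hypotheses (e_sym : symmetric e) (e_irr : irreflexive e).

Definition graph_two_graph : hypergraph :=
  @Hypergraph T [set E : {set T} | [exists x, [exists y, [exists z,
    odd_triple e x y z && (E == [set x; y; z])]]]].

Lemma odd_triple_uniq x y z : odd_triple e x y z -> uniq [:: x; y; z].
Proof.
rewrite /odd_triple /= !inE; case: (eqVneq x y) => [->|_].
  by rewrite e_irr addbb.
case: (eqVneq x z) => [->|_]; first by rewrite e_irr (e_sym y) addbb.
by case: (eqVneq y z) => [->|//]; rewrite e_irr addbF addbb.
Qed.

Lemma mem_graph_two_graph x y z :
  ([set x; y; z] \in hyperedges graph_two_graph) = odd_triple e x y z.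
Proof.
rewrite inE; apply/existsP/idP=> [|exyz]; last first.
  exists x; apply/existsP; exists y; apply/existsP; exists z.
  by rewrite exyz eqxx.
case=> a /existsP[b] /existsP[c] /andP[eabc /eqP/setP Exyz].
have /eqP := odd_triple_uniq eabc.
rewrite -cards3 -(eq_card Exyz) cards3 => /eqP Ux.
move: (Exyz x) (Exyz y) (Exyz z) Ux; rewrite !inE !eqxx !orbT /= !inE negb_or.
move=> + + + /andP[/andP[+ +] /andP[+ _]].
(* Each of [x], [y], [z] is one of [a], [b], [c]; distinctness leaves the six permutations, and
   symmetry of [e] makes the parity independent of the order. *)
by do 3![case/esym/orP=> [/orP[]|] /eqP->]; rewrite ?eqxx //= => _ _ _;
   move: eabc; rewrite /odd_triple ?(e_sym b a) ?(e_sym c a) ?(e_sym c b);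
   do 3 case: (e _ _).
Qed.

(** Each edge inside a four-set lies in exactly two of its four triples, so the four parities sum to
    zero. *)
Lemma graph_two_graphP : two_graph graph_two_graph.
Proof.
have uni3 : uniform 3 graph_two_graph.
  move=> E; rewrite inE => /existsP[x] /existsP[y] /existsP[z] /andP[].
  by move/odd_triple_uniq=> Us /eqP->; apply/eqP; rewrite cards3.
split=> // S /cards4_ex[a [b [c [d [Us ->]]]]].
rewrite (card_hyperedges4 uni3 Us) !mem_graph_two_graph !oddD !oddb /odd_triple.
by do 6 case: (e _ _).
Qed.

End GraphTwoGraph.

(** Fix a vertex [a] and join [x] to [y] when [a], [x], [y] form a hyperedge; evenness on the
    four-set of [a], [x], [y], [z] is then the required identity. *)
Lemma two_graph_coboundary (A : hypergraph) :
  two_graph A -> exists e : rel A, [/\ symmetric e, irreflexive e &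
    forall x y z, ([set x; y; z] \in hyperedges A) = odd_triple e x y z].
Proof.
case=> uniA A4; case: (pickP A) => [a _|A0]; last first.
  by exists (fun _ _ => false); split=> // x; have := A0 x.
pose t x y z := [set x; y; z] \in hyperedges A.
have t_uniq x y z : ~~ uniq [:: x; y; z] -> t x y z = false.
  by rewrite -cards3; apply: contraNF => /uniA ->.
have t12 x y z : t x y z = t y x z by rewrite /t (setUC [set x]).
have t23 x y z : t x y z = t x z y by rewrite /t setUAC.
have txx x y : t x x y = false by rewrite t_uniq //= inE eqxx.
have txyy x y : t x y y = false by rewrite t_uniq //= !inE eqxx andbF.
exists (t a); split=> [x y|x|x y z]; [exact: t23 | exact: txyy |].
rewrite -/(t x y z) /odd_triple.
(* Without four distinct vertices the parity condition says nothing, and each coincidence is checked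
   by hand. *)
case Us: (uniq [:: a; x; y; z]); last first.
  case: (eqVneq x y) Us => [<-|xy]; first by rewrite txx txyy addbb.
  case: (eqVneq x z) => [<-|xz].
    by rewrite (t23 a y) addbb txyy t23 txx.
  case: (eqVneq y z) => [<-|yz]; first by rewrite !txyy addbF addbb.
  case: (eqVneq a x) => [<-|ax]; first by rewrite !txx addbF.
  case: (eqVneq a y) => [<-|ay]; first by rewrite (t23 a x) !txx t12.
  case: (eqVneq a z) => [<-|az].
    by rewrite !(t23 a _ a) !txx !addbF t23 t12 t23.
  by rewrite /= !inE !negb_or ax ay az xy xz yz.
have := A4 _ (cards4 Us); rewrite (card_hyperedges4 uniA Us) !oddD !oddb.
by rewrite -!/(t _ _ _); do 4 case: (t _ _ _).
Qed.

(** * The graph on valuations and its switching maps *)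

Section ValuationGraph.

Variables (V : finType) (e : rel V).
Hypotheses (e_sym : symmetric e) (e_irr : irreflexive e).

Definition valuation_vertex : finType := (V * {ffun V -> bool})%type.

Definition valuation_edge (u v : valuation_vertex) : bool :=
  u.2 v.1 (+) v.2 u.1.

Lemma valuation_edge_sym : symmetric valuation_edge.
Proof. by move=> u v; rewrite /valuation_edge addbC. Qed.

Lemma valuation_edge_irr : irreflexive valuation_edge.
Proof. by move=> u; rewrite /valuation_edge addbb. Qed.

(* Each edge of the graph is recorded by exactly one of its two ends. *)
Definition canonical_valuation (x : V) : {ffun V -> bool} :=
  [ffun y => (enum_rank y < enum_rank x) && e x y].

Definition valuation_embed (x : V) : valuation_vertex :=
  (x, canonical_valuation x).

Lemma valuation_embed_edge x y :
  valuation_edge (valuation_embed x) (valuation_embed y) = e x y.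
Proof.
rewrite /valuation_edge /= !ffunE (e_sym y x).
case: ltngtP => //=; rewrite ?addbF // => /val_inj/enum_rank_inj ->.
by rewrite e_irr.
Qed.

(* s x is the change that g makes to the edge joining x to a base point of S. *)
Lemma switching_function (S : {set V}) (g : V -> V) :
  {in S & &, forall x y z,
     odd_triple e (g x) (g y) (g z) = odd_triple e x y z} ->
  exists s : V -> bool, {in S &, forall x y,
     e (g x) (g y) (+) e x y = s x (+) s y}.
Proof.
move=> gS; case: (pickP (mem S)) => [a /= aS|S0]; last first.
  by exists xpred0 => x y xS; have := S0 x; rewrite /= xS.
exists (fun x => e (g a) (g x) (+) e a x) => x y xS yS.
(* Comparing the parities of [a], [x], [y] before and after [g] isolates the change on the pair [x],
   [y]. *)
have := gS _ _ _ aS xS yS; rewrite /odd_triple.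
by do 6 case: (e _ _).
Qed.

Section Extension.

Variables (S : {set V}) (g : {perm V}) (s : V -> bool).
Hypothesis gs : {in S &, forall x y, e (g x) (g y) (+) e x y = s x (+) s y}.

(* The function F of the introduction. *)
Definition flip (x y : V) : bool :=
  if x \in S then canonical_valuation (g x) (g y) (+) canonical_valuation x y
  else (y \in S) && (canonical_valuation (g y) (g x) (+)
                     canonical_valuation y x (+) s y).

(** Set to zero outside [S], where [gs] gives no information on [s]. *)
Definition valuation_switch (x : V) : bool := (x \in S) && s x.

Definition valuation_extend (u : valuation_vertex) : valuation_vertex :=
  (g u.1, [ffun y => u.2 ((g^-1)%g y) (+) flip u.1 ((g^-1)%g y)]).


(** Rows of [flip] at points of [S] are forced by sending canonical valuations to canonical ones,
    and [gs] makes them compatible. If only one point is in [S], the other row is free and is chosen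
    to fit. *)
Lemma flip_switch x y :
  flip x y (+) flip y x = valuation_switch x (+) valuation_switch y.
Proof.
rewrite /flip /valuation_switch; case xS: (x \in S); case yS: (y \in S) => //=.
- rewrite -gs // -!valuation_embed_edge /valuation_edge /=.
  by do 4 case: (canonical_valuation _ _).
- by rewrite addKb addbF.
- by rewrite addbC addKb.
Qed.

Lemma valuation_extend_edge u v :
  valuation_edge (valuation_extend u) (valuation_extend v) =
  valuation_edge u v (+) (valuation_switch u.1 (+) valuation_switch v.1).
Proof.
rewrite -flip_switch /valuation_edge /= !ffunE !permK.
by rewrite addbACA.
Qed.

Lemma valuation_extend_inj : injective valuation_extend.
Proof.
move=> [x p] [y q] [/perm_inj <- /ffunP pq]; congr (_, _); apply/ffunP=> z.
by have := pq (g z); rewrite !ffunE permK; apply: addIb.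
Qed.

(** On a row in [S], [flip] cancels the canonical valuation of [x] and puts in that of [g x]. *)
Lemma valuation_extendE x :
  x \in S -> valuation_extend (valuation_embed x) = valuation_embed (g x).
Proof.
move=> xS; congr (_, _); apply/ffunP=> y.
by rewrite ffunE /flip /= xS permKV addbC addbK.
Qed.

End Extension.
End ValuationGraph.

Theorem theorem1p1 : has_EPPA two_graph.
Proof.
move=> A tgA; have [e [e_sym e_irr eA]] := two_graph_coboundary tgA.
have [uniA _] := tgA.
pose B := graph_two_graph (@valuation_edge A).
have tgB : two_graph B.
  exact: graph_two_graphP (@valuation_edge_sym A) (@valuation_edge_irr A).
have [uniB _] := tgB.
have memB := mem_graph_two_graph (@valuation_edge_sym A) (@valuation_edge_irr A).
exists B; split=> //; exists (valuation_embed e); split.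
  apply: uniform3_embedding => // [x y [] //|x y z].
  by rewrite memB eA /odd_triple !valuation_embed_edge.
move=> S S' phi [[psi phiK _] phiE].
(* The identity is only a default outside [S]: extending to a permutation looks at [f] on [S]
   alone. *)
pose f x : A := if insub x is Some u then val (phi u) else x.
have fE (u : induced S) : f (val u) = val (phi u) by rewrite /f valK.
have f_inj : {in S &, injective f}.
  move=> x y xS yS; rewrite -[x](SubK {x | x \in S} xS).
  rewrite -[y](SubK {x | x \in S} yS) !fE.
  by move/val_inj/(can_inj phiK) ->.
have [g gf] := perm_extension f_inj.
have gE (u : induced S) : g (val u) = val (phi u) by rewrite gf ?fE ?(valP u).
have gS : {in S & &, forall x y z,
     odd_triple e (g x) (g y) (g z) = odd_triple e x y z}.
  move=> x y z xS yS zS; pose u := Sub x xS : induced S.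
  pose v := Sub y yS : induced S; pose w := Sub z zS : induced S.
  have := phiE [set u; v; w].
  by rewrite !inE !imsetU !imset_set1 -!gE !eA.
have [s gs] := switching_function gS.
exists (valuation_extend e S g s); split; last first.
  by move=> u; rewrite valuation_extendE ?gE ?(valP u).
have ext_inj := @valuation_extend_inj _ e S g s.
pose theta : B -> B := valuation_extend e S g s.
suff [_ thetaE] : embedding theta by split; first exact: injF_bij.
apply: uniform3_embedding => // x y z.
rewrite !memB /odd_triple !(valuation_extend_edge e_sym e_irr gs).
(* Each vertex lies in two pairs of the triple, so its switch value cancels. *)
by do 3 case: (valuation_edge _ _); do 3 case: (valuation_switch _ _ _).
Qed.
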